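(* Let $d$ be prime, $n\ge1$, and $\rho$ an $n$-qudit state. Then $\vec\lambda_{\mathcal M(\rho)}\prec\vec\lambda_\rho$, where $\vec\lambda_\tau\in\mathbb R^{d^n}$ denotes the vector of eigenvalues of $\tau$ (with multiplicity). Consequently, for every Schur-concave function $f$ of the spectrum, $f(\rho)\le f(\mathcal M(\rho))$.
   Context: Fix a prime $d$ and $n\ge1$; $\mathcal H=\mathbb C^d$, $\chi(k)=e^{2\pi ik/d}$, $X|k\rangle=|k+1\rangle$, $Z|k\rangle=\chi(k)|k\rangle$. Weyl operators: $w(p,q)=\chi(-2^{-1}pq)Z^pX^q$ for odd $d$, $w(p,q)=i^{-pq}Z^pX^q$ for $d=2$, and $w(\vec p,\vec q)=\bigotimes_k w(p_k,q_k)$ for $(\vec p,\vec q)\in V^n=\mathbb Z_d^n\times\mathbb Z_d^n$. Characteristic function: $\Xi_\rho(\vec p,\vec q)=\mathrm{Tr}[\rho\,w(-\vec p,-\vec q)]$. The mean state $\mathcal M(\rho)$ is the operator with $\Xi_{\mathcal M(\rho)}(\vec x)=\Xi_\rho(\vec x)$ if $|\Xi_\rho(\vec x)|=1$ and $0$ otherwise. For probability vectors $\vec p,\vec q\in\mathbb R^m$, $\vec p\prec\vec q$ means $\sum_{i\le k}p_i^\downarrow\le\sum_{i\le k}q_i^\downarrow$ for all $k$, where $\downarrow$ denotes decreasing rearrangement. $f$ is Schur concave if $\vec p\prec\vec q$ implies $f(\vec p)\ge f(\vec q)$; for a state, $f(\rho):=f(\vec\lambda_\rho)$. *)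

(* Defs.v *)
From HB Require Import structures.
From mathcomp Require Import all_boot all_order all_algebra.
From mathcomp Require Import complex.
From mathcomp Require Import reals trigo.

Set Implicit Arguments.
Unset Strict Implicit.
Unset Printing Implicit Defensive.

Import Order.TTheory GRing.Theory Num.Theory.
Local Open Scope ring_scope.
Local Open Scope complex_scope.

Section Qudits.
Variable R : realType.
Variable d : nat.
Local Notation C := R[i].

Definition Qd := 'Z_d.
(* n-qudit basis labels: functions 'I_n -> Z_d; operators on (C^d)^{(x)n}
   are matrices indexed by the enumeration of this finite type *)
Definition Qn (n : nat) := {ffun 'I_n -> 'Z_d}.

Definition omega : C :=
  (cos (2 * pi / d%:R)) +i* (sin (2 * pi / d%:R)).
Definition chi (k : 'Z_d) : C := omega ^+ (val k).

(* X|k> = |k+1>,  Z|k> = chi(k)|k> on C^d, as matrices indexed by enum 'Z_d *)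
Definition Xop : 'M[C]_#|Qd| :=
  \matrix_(i, j) ((enum_val i == enum_val j + 1 :> 'Z_d)%:R).
Definition Zop : 'M[C]_#|Qd| :=
  \matrix_(i, j) ((i == j)%:R * chi (enum_val j)).

Definition weyl1 (p q : 'Z_d) : 'M[C]_#|Qd| :=
  (if d == 2 then 'i%C ^- (val p * val q)
   else chi (- (2%:R)^-1 * p * q)) *: (Zop ^+ val p *m Xop ^+ val q).

(* n-qudit Weyl operator w(p,q) = (x)_k w(p_k, q_k), written entrywise *)
Definition weyl (n : nat) (p q : Qn n) : 'M[C]_#|Qn n| :=
  \matrix_(i, j) \prod_(k < n)
     weyl1 (p k) (q k) (enum_rank ((enum_val i : Qn n) k)) (enum_rank ((enum_val j : Qn n) k)).

Definition charfun (n : nat) (rho : 'M[C]_#|Qn n|) (p q : Qn n) : C :=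
  \tr (rho *m weyl [ffun k => - p k] [ffun k => - q k]).

Definition is_mean_state (n : nat) (rho M : 'M[C]_#|Qn n|) : Prop :=
  forall p q : Qn n,
    charfun M p q = if `|charfun rho p q| == 1 then charfun rho p q else 0.

End Qudits.

Definition psd (R : realType) (m : nat) (A : 'M[R[i]]_m) : Prop :=
  (map_mx Num.conj A)^T = A /\
  forall v : 'cV[R[i]]_m, 0 <= ((map_mx Num.conj v)^T *m A *m v) 0 0.
Definition is_state (R : realType) (m : nat) (A : 'M[R[i]]_m) : Prop :=
  psd A /\ \tr A = 1.

Definition is_spectrum (R : realType) (m : nat) (A : 'M[R[i]]_m) (s : seq R[i]) : Prop :=
  char_poly A = \prod_(x <- s) ('X - x%:P).

Definition sort_desc (R : realType) (s : seq R) : seq R := sort (fun x y => y <= x) s.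
Definition majorized (R : realType) (p q : seq R) : Prop :=
  size p = size q /\
  forall k : nat, \sum_(i < k) nth 0 (sort_desc p) i <= \sum_(i < k) nth 0 (sort_desc q) i.

Definition prob_vec (R : realType) (m : nat) (p : seq R) : Prop :=
  size p = m /\ all (fun x => 0 <= x) p /\ \sum_(x <- p) x = 1.

Definition schur_concave (R : realType) (m : nat) (f : seq R -> R) : Prop :=
  forall p q : seq R, prob_vec m p -> prob_vec m q -> majorized p q -> f q <= f p.

(* Main.v *)
Require Import Defs.
From HB Require Import structures.
From mathcomp Require Import all_boot all_order all_algebra.
From mathcomp Require Import complex.
From mathcomp Require Import reals trigo ring lra.
Import Order.TTheory GRing.Theory Num.Theory.
Local Open Scope ring_scope.

(** Let S be the set of phase-space points x with |Xi_rho(x)| = 1. Equality in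
    |tr(rho U)| <= 1 forces w(-x) rho = Xi_rho(x) rho for x in S, so the operators
    Xi_rho(x) w(x), x in S, fix rho; as they compose up to a phase like the
    points of S, they form an abelian group of unitaries. By completeness of the
    Weyl operators, M(rho) = D^-1 sum_(x in S) Xi_rho(x) w(x) with D = d^n, which
    is a = |S| / D times the projection onto the common fixed space of that group.
    Hence the spectrum of M(rho) consists of zeros and a's, while rho is
    supported in the range of M(rho), i.e. has at most 1 / a nonzero
    eigenvalues. A flat spectrum is majorized by every probability vector
    with no more nonzero entries. *)

Set Implicit Arguments.
Unset Strict Implicit.
Unset Printing Implicit Defensive.
Local Open Scope sesquilinear_scope.

(** * Positive matrices: spectral form, square-root factors, equality in the trace bound *)

Section PositiveMatrices.
Variable C : numClosedFieldType.

Lemma adjmxM m n p (A : 'M[C]_(m, n)) (B : 'M[C]_(n, p)) :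
  (A *m B)^t* = B^t* *m A^t*.
Proof. by rewrite trmx_mul map_mxM. Qed.

Lemma adjmxZ m n (a : C) (A : 'M[C]_(m, n)) : (a *: A)^t* = a^* *: A^t*.
Proof. by apply/matrixP => i j; rewrite !mxE rmorphM. Qed.

Lemma adjmxB m n (A B : 'M[C]_(m, n)) : (A - B)^t* = A^t* - B^t*.
Proof. by apply/matrixP => i j; rewrite !mxE rmorphB. Qed.

Lemma mxtrace_adj n (A : 'M[C]_n) : \tr (A^t*) = (\tr A)^*.
Proof. by rewrite rmorph_sum; apply: eq_bigr => i _; rewrite !mxE. Qed.

Lemma mulmx_adj_diag m n (A : 'M[C]_(m, n)) i :
  (A *m A^t*) i i = \sum_j `|A i j| ^+ 2.
Proof. by rewrite mxE; apply: eq_bigr => j _; rewrite !mxE normCK. Qed.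

Lemma mxtrace_mul_adj_eq0 m n (A : 'M[C]_(m, n)) :
  \tr (A *m A^t*) = 0 -> A = 0.
Proof.
move=> tr0; apply/matrixP => i j; rewrite mxE.
have diag_ge0 k : 0 <= (A *m A^t*) k k.
  by rewrite mulmx_adj_diag sumr_ge0 // => l _; rewrite exprn_ge0.
have /eqP := tr0; rewrite psumr_eq0 // => /allP /(_ i (mem_index_enum _)).
rewrite mulmx_adj_diag psumr_eq0 => [|k _]; last exact: exprn_ge0.
move=> /allP /(_ j (mem_index_enum _)) /=.
by rewrite expf_eq0 normr_eq0 /= => /eqP.
Qed.

(* Equality case of [|tr(rho U)| <= 1]: with [rho = L L^+] and [c = tr(rho U)],
   the matrix [N = U L - c L] satisfies [tr(N N^+) = 2 - 2 |c|^2 = 0]. *)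
Lemma unitary_expectation_norm1 n (L U : 'M[C]_n) :
  U^t* *m U = 1%:M -> \tr (L *m L^t*) = 1 ->
  `|\tr (L *m L^t* *m U)| = 1 ->
  U *m (L *m L^t*) = \tr (L *m L^t* *m U) *: (L *m L^t*).
Proof.
set c := \tr (_ *m U) => UU trL c1.
have ccE : c * c^* = 1 by rewrite -normCK c1 expr1n.
suff N0 : U *m L - c *: L = 0.
  by apply/eqP; rewrite -subr_eq0 mulmxA scalemxAl -mulmxBl N0 mul0mx.
apply: mxtrace_mul_adj_eq0.
rewrite adjmxB adjmxZ adjmxM mulmxBl !mulmxBr !raddfB /=.
rewrite -!scalemxAl -!scalemxAr !linearZ /=.
have -> : \tr (U *m L *m (L^t* *m U^t*)) = 1.
  by rewrite !mulmxA mxtrace_mulC !mulmxA UU mul1mx trL.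
have -> : \tr (U *m L *m L^t*) = c by rewrite -mulmxA mxtrace_mulC.
have -> : \tr (L *m (L^t* *m U^t*)) = c^*.
  rewrite -[RHS]mxtrace_adj !adjmxM trmxCK mulmxA mxtrace_mulC.
  by rewrite mulmxA.
by rewrite trL mulr1 [c^* * c]mulrC ccE !subrr add0r .
Qed.

Lemma psd_spectral m (A : 'M[C]_m) : A^t* = A ->
  (forall v : 'cV[C]_m, 0 <= (v^t* *m A *m v) 0 0) ->
  exists (P : 'M[C]_m) (D : 'rV[C]_m),
  [/\ P *m P^t* = 1%:M, P^t* *m P = 1%:M, forall j, 0 <= D 0 j
    & A = P^t* *m diag_mx D *m P].
Proof.
move=> Aadj Apos.
have /orthomx_spectralP AE : A \is normalmx.
  by apply/normalmxP; rewrite Aadj.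
have PU := spectral_unitarymx A; rewrite invmx_unitary // in AE.
set P := spectralmx A in PU AE; set D := spectral_diag A in AE.
have PP : P *m P^t* = 1%:M by apply/unitarymxP.
have PP' : P^t* *m P = 1%:M by apply: mulmx1C.
exists P, D; split => // j.
(* The test vector is the [j]-th eigenvector, so the quadratic form evaluates to [D 0 j]. *)
have := Apos (P^t* *m delta_mx j 0).
rewrite {1}AE.
have -> : (P^t* *m delta_mx j 0)^t* = (delta_mx j (0 : 'I_1))^T *m P.
  rewrite adjmxM trmxCK; congr (_ *m _).
  by apply/matrixP => a b; rewrite !mxE; case: (_ && _); rewrite ?rmorph1 ?rmorph0.
rewrite !mulmxA -[_ *m P *m P^t*]mulmxA PP mulmx1 -[_ *m P *m P^t*]mulmxA PP mulmx1.
by rewrite trmx_delta -rowE -colE !mxE eqxx mulr1n.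
Qed.

(** The factor is [P^t*] times the square root of the diagonal part; it puts a state into the form
    required by the equality case above. *)
Lemma psd_factor m (A : 'M[C]_m) : A^t* = A ->
  (forall v : 'cV[C]_m, 0 <= (v^t* *m A *m v) 0 0) ->
  exists L : 'M[C]_m, A = L *m L^t*.
Proof.
move=> Aadj /(psd_spectral Aadj) [P [D [_ _ Dpos ->]]].
pose S := diag_mx (\row_j sqrtC (D 0 j)).
exists (P^t* *m S); rewrite adjmxM trmxCK !mulmxA; congr (_ *m _).
rewrite -!mulmxA; congr (_ *m _); apply/matrixP => i j.
rewrite /S tr_diag_mx map_diag_mx mul_diag_mx !mxE.
case: eqP => [->|_]; last by rewrite !mulr0n mulr0.
rewrite !mulr1n [X in _ = _ * X]conj_Creal; last by rewrite ger0_real // sqrtC_ge0.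
by rewrite -expr2 sqrtCK.
Qed.

End PositiveMatrices.

(** * Stabilizer argument for an abstract complete family of Weyl unitaries *)

Section MeanState.
Variables (C : numClosedFieldType) (V : finZmodType) (m : nat).
Variables (W : V -> 'M[C]_m) (b : V -> V -> C).
Hypothesis m_gt0 : (0 < m)%N.
Hypothesis W0 : W 0 = 1%:M.
Hypothesis WM : forall x y, W x *m W y = b x y *: W (x + y).
Hypothesis b_norm : forall x y, `|b x y| = 1.
Hypothesis W_adj : forall x, (W x)^t* = W (- x).
Hypothesis W_unit : forall x, W x *m W (- x) = 1%:M.
Hypothesis W_complete : forall A : 'M[C]_m,
  m%:R *: A = \sum_x \tr (A *m W (- x)) *: W x.

Variables (L M : 'M[C]_m).
Let rho := L *m L^t*.
Let xi x := \tr (rho *m W (- x)).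
Let S := [pred x | `|xi x| == 1].
Hypothesis rho_tr : \tr rho = 1.
Hypothesis M_mean : forall x, \tr (M *m W (- x)) = if S x then xi x else 0.

Let rho_adj : rho^t* = rho.
Proof. by rewrite /rho adjmxM trmxCK. Qed.

Let fixed_by x : S x -> W (- x) *m rho = xi x *: rho.
Proof.
move=> /eqP Sx; apply: unitary_expectation_norm1 => //.
by rewrite W_adj opprK W_unit.
Qed.

Let xi0 : xi 0 = 1.
Proof. by rewrite /xi oppr0 W0 mulmx1. Qed.

Let xiN x : xi (- x) = (xi x)^*.
Proof. by rewrite /xi -mxtrace_adj adjmxM W_adj rho_adj mxtrace_mulC. Qed.

Let SN x : S (- x) = S x.
Proof. by rewrite /S /= xiN norm_conjC. Qed.

Let xi_conj x : S x -> xi x * (xi x)^* = 1.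
Proof. by move=> /eqP Sx; rewrite -normCK Sx expr1n. Qed.

(** Both unitaries act on [rho] by scalars while their product is a multiple of [W (- (x + y))]; the
    traces are compared. Nothing is assumed about [x + y], so taking norms gives closure of [S]
    under addition. *)
Let xiD x y : S x -> S y -> b (- x) (- y) * xi (x + y) = xi x * xi y.
Proof.
move=> Sx Sy.
have : W (- x) *m W (- y) *m rho = (xi y * xi x) *: rho.
  by rewrite -mulmxA fixed_by // -scalemxAr fixed_by // scalerA.
rewrite WM -scalemxAl => /(congr1 mxtrace); rewrite !linearZ /= rho_tr mulr1.
by rewrite mxtrace_mulC -opprD => ->; rewrite mulrC.
Qed.

Let SD x y : S x -> S y -> S (x + y).
Proof.
move=> Sx Sy; have /(congr1 Num.norm) := xiD Sx Sy.
rewrite !normrM b_norm mul1r (eqP Sx) (eqP Sy) mulr1 => xy1.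
by rewrite /S /= xy1.
Qed.

Let SDr x y : S x -> S (x + y) = S y.
Proof.
move=> Sx; apply/idP/idP => [Sxy|]; last exact: SD.
by rewrite -[y](addKr x); apply: SD => //; rewrite SN.
Qed.

(** The factors are reversed because the adjoint of [W (- x) *m W (- y)] is [W y *m W x]. The
    conjugate of [b (- x) (- y)] then meets the same value coming from [xiD], and their product is
    1. *)
Let stabM x y : S x -> S y ->
  (xi y *: W y) *m (xi x *: W x) = xi (x + y) *: W (x + y).
Proof.
move=> Sx Sy; rewrite -scalemxAl -scalemxAr scalerA.
have -> : W y *m W x = (b (- x) (- y))^* *: W (x + y).
  by rewrite -[LHS]trmxCK adjmxM !W_adj WM adjmxZ W_adj -opprD opprK.
rewrite scalerA [xi y * _]mulrC -xiD // mulrAC -normCK b_norm expr1n.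
by rewrite mul1r.
Qed.

Let ME : m%:R *: M = \sum_(x | S x) xi x *: W x.
Proof.
rewrite W_complete [RHS]big_mkcond; apply: eq_bigr => x _.
by rewrite M_mean; case: ifP; rewrite ?scale0r.
Qed.

Let m_neq0 : m%:R != 0 :> C.
Proof. by rewrite pnatr_eq0 -lt0n. Qed.

Let a : C := #|S|%:R / m%:R.

Let aE : m%:R * a = #|S|%:R.
Proof. by rewrite /a mulrC divfK. Qed.

(** In the sum for [m%:R *: M], multiplication by one term permutes the terms, and every term fixes
    [rho]. Each fact produces a factor [#|S|], whence the scale [#|S| / m]. *)
Lemma mean_state_projection :
  exists a : C, [/\ 0 < a, M^t* = M, M *m M = a *: M, M *m rho = a *: rho
    & \tr M = 1].
Proof.
exists a; split.
- rewrite divr_gt0 ?ltr0n //; apply/card_gt0P; exists 0.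
  by rewrite inE xi0 normr1.
- apply: (scalerI m_neq0); rewrite -[X in X *: _]conjC_nat -adjmxZ ME.
  rewrite !raddf_sum [RHS](reindex_inj (inv_inj (@opprK V))) /=.
  rewrite [RHS](eq_bigl _ _ SN); apply: eq_bigr => x _.
  by rewrite adjmxZ W_adj xiN.
- suff MM : (m%:R *: M) *m (m%:R *: M) = #|S|%:R *: (m%:R *: M).
    apply: (scalerI m_neq0); apply: (scalerI m_neq0); rewrite [in LHS]scalemxAr scalemxAl MM.
    by rewrite !scalerA -aE; congr (_ *: _); ring.
  (* Translation by a point of [S] maps [S] onto itself. *)
  have shift y : S y -> \sum_(x | S x) xi (x + y) *: W (x + y) = m%:R *: M.
    move=> Sy; rewrite ME [RHS](reindex_inj (addIr y)).
    by apply: eq_bigl => x; rewrite addrC SDr.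
  rewrite {1 2}ME mulmx_suml.
  under eq_bigr => y Sy.
    rewrite mulmx_sumr (eq_bigr _ (fun x Sx => stabM Sx Sy)) shift //.
    over.
  by rewrite sumr_const [RHS]scaler_nat; congr (_ *+ _); apply: eq_card.
- apply: (scalerI m_neq0); rewrite [LHS]scalemxAl ME scalerA aE mulmx_suml.
  under eq_bigr => x Sx.
    (* Read as [W (- - x)], the operator acts on [rho] by [xi (- x)], the conjugate of [xi x], and
       the two phases cancel. *)
    rewrite -scalemxAl -[x in W x]opprK fixed_by ?SN // scalerA xiN xi_conj //.
    rewrite scale1r; over.
  by rewrite sumr_const [RHS]scaler_nat; congr (_ *+ _); apply: eq_card.
(* The trace of [M] is its coefficient at 0, a point of [S]. *)
by have := M_mean 0; rewrite /S /= xi0 normr1 eqxx oppr0 W0 mulmx1.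
Qed.

End MeanState.

(** * Majorization of bounded vectors by vectors with few nonzero entries *)

Section Majorization.
Variable R : realType.
Implicit Types (p q s : seq R).

Lemma sum_nth_ge_size s k : (size s <= k)%N ->
  \sum_(0 <= i < k) nth 0 s i = \sum_(x <- s) x.
Proof.
move=> sk; rewrite [RHS](big_nth 0) (big_cat_nat _ sk) //= -[RHS]addr0; congr (_ + _).
by rewrite big_nat big1 // => i /andP[si _]; rewrite nth_default.
Qed.

Lemma perm_sort_desc s : perm_eq (sort_desc s) s.
Proof. by rewrite perm_sort. Qed.

Lemma nth_sort_desc_ge0 s i :
  (forall x, x \in s -> 0 <= x) -> 0 <= nth 0 (sort_desc s) i.
Proof.
move=> s_ge0; case: (ltnP i (size (sort_desc s))) => [lt_i|ge_i].
  by apply: s_ge0; rewrite -(perm_mem (perm_sort_desc s)) mem_nth.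
by rewrite nth_default.
Qed.

(** Nonnegativity extends the monotonicity past the end of the list, where [nth] returns 0. *)
Lemma nth_sort_desc_anti s i j : (forall x, x \in s -> 0 <= x) ->
  (i <= j)%N -> nth 0 (sort_desc s) j <= nth 0 (sort_desc s) i.
Proof.
move=> s_ge0 le_ij; case: (ltnP j (size (sort_desc s))) => [lt_j|ge_j]; last first.
  by rewrite [nth _ _ j]nth_default // nth_sort_desc_ge0.
have sorted_s : sorted (fun x y : R => y <= x) (sort_desc s).
  by apply: sort_sorted => x y; exact: le_total.
apply: (sorted_leq_nth _ _ _ sorted_s) => //.
- by move=> x y z /[swap]; exact: le_trans.
- by rewrite inE (leq_ltn_trans le_ij).
Qed.

(** By monotonicity a nonzero entry at position [i] makes the first [i + 1] entries nonzero, so the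
    count exceeds [i]. *)
Lemma nth_sort_desc_eq0 s i : (forall x, x \in s -> 0 <= x) ->
  (count (predC1 (0 : R)%R) s <= i)%N -> nth 0 (sort_desc s) i = 0.
Proof.
move=> s_ge0; apply: contraTeq => nz_i; rewrite -ltnNge.
have lt_i : (i < size (sort_desc s))%N.
  by rewrite ltnNge; apply: contra nz_i => ?; rewrite nth_default.
rewrite -(seq.permP (perm_sort_desc s)) -(cat_take_drop i.+1 (sort_desc s)).
rewrite count_cat; apply: leq_trans (leq_addr _ _).
suff : all (predC1 (0 : R)%R) (take i.+1 (sort_desc s)).
  by rewrite all_count size_takel // => /eqP->.
apply/(all_nthP 0) => j; rewrite size_takel // ltnS => le_ji.
rewrite nth_take //= gt_eqF // (lt_le_trans _ (nth_sort_desc_anti s_ge0 le_ji)) //.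
by rewrite lt_def nz_i nth_sort_desc_ge0.
Qed.

Lemma sum_sort_desc s : \sum_(x <- sort_desc s) x = \sum_(x <- s) x.
Proof. exact: perm_big (perm_sort_desc s). Qed.

(* The averages of a nonincreasing sequence decrease. *)
Lemma sum_sort_desc_ge s k N : (forall x, x \in s -> 0 <= x) ->
  (count (predC1 (0 : R)%R) s <= N)%N -> (k <= N)%N ->
  k%:R * \sum_(x <- s) x <= N%:R * \sum_(0 <= i < k) nth 0 (sort_desc s) i.
Proof.
move=> s_ge0 le_sN le_kN; set f := nth 0 (sort_desc s).
have -> : \sum_(x <- s) x = \sum_(0 <= i < N) f i.
  (* The sum is padded with zeros to at least [N] terms and then cut at [N], beyond which all sorted
     entries vanish. *)
  rewrite -sum_sort_desc -(sum_nth_ge_size (leq_maxl _ N)).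
  rewrite (big_cat_nat _ (leq_maxr (size (sort_desc s)) N)) //=.
  rewrite [X in _ + X]big_nat [X in _ + X]big1 ?addr0 // => i /andP[le_Ni _].
  by apply: nth_sort_desc_eq0 => //; apply: leq_trans le_Ni.
rewrite (big_cat_nat _ le_kN) //=; set T := \sum_(0 <= i < k) f i.
have tail_le : \sum_(k <= i < N) f i <= (N - k)%:R * f k.
  rewrite mulr_natl -sumr_const_nat.
  rewrite !big_nat ler_sum // => i /andP[le_ki _].
  exact: nth_sort_desc_anti.
have head_ge : k%:R * f k <= T.
  rewrite mulr_natl -[X in _ *+ X]subn0 -sumr_const_nat /T !big_nat ler_sum //.
  by move=> i /andP[_ lt_ik]; apply: nth_sort_desc_anti => //; exact: ltnW.
have k_ge0 : 0 <= k%:R :> R by [].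
have Nk_ge0 : 0 <= (N - k)%:R :> R by [].
have NE : N%:R = k%:R + (N - k)%:R :> R by rewrite -natrD subnKC.
(* What remains is that [k] times the tail is at most [(N - k) * T]; both are compared with
   [k * (N - k) * f k]. *)
rewrite NE; nra.
Qed.

(** Let [N] be the number of nonzero entries of [q]. For [k <= N] the partial sum of [p] is at most
    [a * k <= k / N], which bounds that of [q] from below; for larger [k] the partial sum of [q] has
    already reached 1. *)
Lemma bounded_majorized (a : R) p q : size p = size q ->
  (forall x, x \in p -> 0 <= x <= a) -> \sum_(x <- p) x = 1 ->
  (forall x, x \in q -> 0 <= x) -> \sum_(x <- q) x = 1 ->
  a * (count (predC1 (0 : R)%R) q)%:R <= 1 -> majorized p q.
Proof.
move=> szpq p_bnd p1 q_ge0 q1 a_le; split => // k.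
have p_ge0 x : x \in p -> 0 <= x by case/p_bnd/andP.
have partial_le1 : \sum_(0 <= i < k) nth 0 (sort_desc p) i <= 1.
  rewrite -p1 -sum_sort_desc -(sum_nth_ge_size (leq_maxl _ k)).
  rewrite [leRHS](big_cat_nat _ (leq_maxr (size (sort_desc p)) k)) //= lerDl.
  by rewrite sumr_ge0 // => i _; exact: nth_sort_desc_ge0.
have a_ge0 : 0 <= a.
  case: p p1 p_bnd {szpq p_ge0 partial_le1} => [|x p _ p_bnd].
    by rewrite big_nil => /eqP; rewrite eq_sym oner_eq0.
  by have /andP[] := p_bnd x (mem_head _ _); exact: le_trans.
have partial_le : \sum_(0 <= i < k) nth 0 (sort_desc p) i <= a * k%:R.
  rewrite mulr_natr -[X in _ *+ X]subn0 -sumr_const_nat ler_sum // => i _.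
  case: (ltnP i (size (sort_desc p))) => [lt_i|ge_i]; last by rewrite nth_default.
  have /p_bnd/andP[] // : nth 0 (sort_desc p) i \in p.
  by rewrite -(perm_mem (perm_sort_desc p)) mem_nth.
rewrite -!(big_mkord xpredT (nth 0 _)).
set N := count _ q in a_le.
have := @sum_sort_desc_ge q (minn k N) N q_ge0 (leqnn _) (geq_minr _ _).
rewrite q1 mulr1; case: (leqP k N) => [le_kN|/ltnW le_Nk] H.
  case: (posnP N) => [N0|N_gt0].
    by move: le_kN; rewrite N0 leqn0 => /eqP->; rewrite !big_geq.
  have : 0 < N%:R :> R by rewrite ltr0n.
  have k_ge0 : 0 <= k%:R :> R by [].
  move: partial_le a_le H; set x := \sum_(_ <= _ < _) _; set y := \sum_(_ <= _ < _) _.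
  move=> xa aN kN N_pos; apply: (le_trans xa).
  rewrite -(ler_pM2l N_pos); apply: le_trans kN; nra.
apply: (le_trans partial_le1).
(* [N = 0] would make every entry of [q] vanish, against the total 1. *)
case: (posnP N) => [N0|N_gt0].
  have := @sum_sort_desc_ge q 1 1 q_ge0; rewrite q1.
  have q0 : \sum_(x <- q) x = 0.
    rewrite big_seq big1 // => x xq; apply/eqP; apply: contraTT isT => x0.
    have : has (predC1 (0 : R)%R) q by apply/hasP; exists x.
    by rewrite has_count -/N N0.
  by move: q1; rewrite q0 => /eqP; rewrite eq_sym oner_eq0.
have {}H : 1 <= \sum_(0 <= i < N) nth 0 (sort_desc q) i.
  by rewrite -(ler_pM2l (_ : 0 < N%:R :> R)) ?ltr0n // mulr1.
rewrite (big_cat_nat _ le_Nk) //= (le_trans H) // lerDl.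
by rewrite sumr_ge0 // => i _; exact: nth_sort_desc_ge0.
Qed.

End Majorization.

(** * Spectra as root lists of characteristic polynomials *)

Section Spectrum.
Variable C : numClosedFieldType.

(** [Q] and [P] lift to constant polynomial matrices, which commute with the scalar matrix ['X%:M];
    their determinants cancel. *)
Lemma char_poly_similar m (A P Q : 'M[C]_m) :
  Q *m P = 1%:M -> char_poly (Q *m A *m P) = char_poly A.
Proof.
move=> QP; rewrite /char_poly /char_poly_mx.
have QPx : map_mx polyC Q *m map_mx polyC P = 1%:M.
  by rewrite -map_mxM QP map_mx1.
have -> : 'X%:M - map_mx polyC (Q *m A *m P) =
    map_mx polyC Q *m ('X%:M - map_mx polyC A) *m map_mx polyC P.
  rewrite mulmxBr mulmxBl !map_mxM; congr (_ - _).
  by rewrite mul_mx_scalar -scalemxAl QPx scalemx1.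
by rewrite !det_mulmx mulrAC -det_mulmx QPx det1 mul1r.
Qed.

Variables (m : nat) (A : 'M[C]_m) (s : seq C).
Hypothesis A_spectrum : char_poly A = \prod_(x <- s) ('X - x%:P).

Lemma spectrum_size : size s = m.
Proof.
by apply/eqP; rewrite -eqSS -(size_prod_XsubC s id) -A_spectrum size_char_poly.
Qed.

Lemma spectrum_sum : (0 < m)%N -> \sum_(x <- s) x = \tr A.
Proof.
move=> m_gt0; apply: oppr_inj; rewrite -char_poly_trace // A_spectrum.
by rewrite -spectrum_size coefPn_prod_XsubC // spectrum_size -lt0n.
Qed.

(** On an eigenvector the relation reads [x * (x - a) = 0]. *)
Lemma spectrum_scaled_projection a : A *m A = a *: A ->
  forall x, x \in s -> (x == 0) || (x == a).
Proof.
move=> AA x xs; have : eigenvalue A x.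
  by rewrite eigenvalue_root_char A_spectrum root_prod_XsubC.
case/eigenvalueP => v vA v0.
have : (x * (x - a)) *: v = 0.
  rewrite mulrBr scalerBl -[x * x *: v]scalerA -vA scalemxAl -vA -mulmxA AA.
  by rewrite -scalemxAr vA scalerA mulrC subrr.
by move/eqP; rewrite scaler_eq0 (negPf v0) orbF mulf_eq0 subr_eq0.
Qed.

(** A split monic polynomial determines its roots up to order. This ties an arbitrary spectrum list
    to the diagonal [D]. *)
Lemma spectrum_diag (P : 'M[C]_m) (D : 'rV[C]_m) : P^t* *m P = 1%:M ->
  A = P^t* *m diag_mx D *m P -> perm_eq s [seq D 0 j | j <- enum 'I_m].
Proof.
move=> PP AE; apply: prod_XsubC_eq; rewrite -A_spectrum AE char_poly_similar //.
rewrite char_poly_trig ?diag_mx_is_trig // big_map big_enum /=.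
by apply: eq_bigr => j _; rewrite !mxE eqxx mulr1n.
Qed.

(* In an eigenbasis of [rho], [M] has the diagonal entry [a] at every nonzero
   eigenvalue of [rho]. *)
Lemma support_bound (a : C) (M P : 'M[C]_m) (D : 'rV[C]_m) :
    0 < a -> M^t* = M -> M *m M = a *: M -> \tr M = 1 ->
    P *m P^t* = 1%:M -> P^t* *m P = 1%:M -> A = P^t* *m diag_mx D *m P ->
    M *m A = a *: A ->
  a * #|[pred j | D 0 j != 0]|%:R <= 1.
Proof.
move=> a_gt0 Madj MM Mtr PP PP' AE MA.
pose N := P *m M *m P^t*.
have N_tr : \tr N = 1 by rewrite /N mxtrace_mulC mulmxA PP' mul1mx.
have N_ge0 j : 0 <= N j j.
  (* A Gram matrix has a nonnegative diagonal. *)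
  have aN : a *: N = (P *m M) *m (P *m M)^t*.
    by rewrite adjmxM Madj /N scalemxAl scalemxAr -MM !mulmxA.
  have := mulmx_adj_diag (P *m M) j; rewrite -aN mxE => aNj.
  by rewrite -(pmulr_rge0 _ a_gt0) aNj sumr_ge0 // => k _; rewrite exprn_ge0.
have ND : N *m diag_mx D = a *: diag_mx D.
  have DE : diag_mx D = P *m A *m P^t*.
    by rewrite AE !mulmxA PP mul1mx -mulmxA PP mulmx1.
  rewrite DE /N !mulmxA -[P *m M *m P^t* *m P]mulmxA PP' mulmx1.
  by rewrite -[P *m M *m A]mulmxA MA -scalemxAr -scalemxAl.
have Na j : D 0 j != 0 -> N j j = a.
  move=> Dj; apply: (mulIf Dj); have /matrixP/(_ j j) := ND.
  by rewrite mul_mx_diag !mxE eqxx mulr1n.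
(* The left side is the part of the trace of [N] over the nonzero eigenvalues; the other diagonal
   entries are nonnegative. *)
rewrite mulr_natr -sumr_const -N_tr /mxtrace [leRHS](bigID [pred j | D 0 j != 0]) /=.
by rewrite (eq_bigr _ Na) lerDl sumr_ge0.
Qed.

End Spectrum.

(** * Passage from complex to real spectra *)

Section RealSpectrum.
Variable R : realType.
Local Notation C := R[i].
Local Notation Re := (@complex.Re R).

Lemma sum_map_Re (s : seq C) : \sum_(x <- map Re s) x = Re (\sum_(x <- s) x).
Proof. by rewrite big_map raddf_sum. Qed.

Lemma scaled_projection_majorized m (a : C) (rho M : 'M[C]_m) (srho sM : seq C) :
    (0 < m)%N -> psd rho -> \tr rho = 1 -> 0 < a ->
    M^t* = M -> M *m M = a *: M -> M *m rho = a *: rho -> \tr M = 1 ->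
    is_spectrum rho srho -> is_spectrum M sM ->
  [/\ prob_vec m (map Re srho), prob_vec m (map Re sM)
    & majorized (map Re sM) (map Re srho)].
Proof.
move=> m_gt0 [rho_adj rho_ge0] rho_tr a_gt0 Madj MM Mrho Mtr rhoS MS.
rewrite map_trmx in rho_adj.
have rho_ge0' (v : 'cV[C]_m) : 0 <= (v^t* *m rho *m v) 0 0.
  by have := rho_ge0 v; rewrite map_trmx.
have [P [D [PP PP' D_ge0 rhoE]]] := psd_spectral rho_adj rho_ge0'.
have sD := spectrum_diag rhoS PP' rhoE.
(* In the order on [R[i]], positivity includes a zero imaginary part. *)
have aE : a = (Re a)%:C%C.
  by have := ltW a_gt0; rewrite lecE => /andP[/eqP a0 _]; case: (a) a0 => x y /= ->.
have a'_gt0 : 0 < Re a by move: a_gt0; rewrite ltcE => /andP[].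
have q_ge0 x : x \in map Re srho -> 0 <= x.
  case/mapP => y; rewrite (perm_mem sD) => /mapP[j _ ->] ->.
  by have := D_ge0 j; rewrite lecE => /andP[].
have p_bnd x : x \in map Re sM -> 0 <= x <= Re a.
  case/mapP => y yM ->; have := spectrum_scaled_projection MS MM yM.
  by case/orP => /eqP->; rewrite ?lexx ltW.
have q1 : \sum_(x <- map Re srho) x = 1.
  by rewrite sum_map_Re (spectrum_sum rhoS m_gt0) rho_tr.
have p1 : \sum_(x <- map Re sM) x = 1.
  by rewrite sum_map_Re (spectrum_sum MS m_gt0) Mtr.
have q_size : size (map Re srho) = m by rewrite size_map (spectrum_size rhoS).
have p_size : size (map Re sM) = m by rewrite size_map (spectrum_size MS).
split.
- by do 2!split => //; apply/allP.
- by do 2!split => //; apply/allP => x /p_bnd/andP[].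
apply: (bounded_majorized (a := Re a)) => //; first by rewrite p_size.
have := support_bound a_gt0 Madj MM Mtr PP PP' rhoE Mrho.
(* The eigenvalues in [D] are nonnegative, hence real, so taking real parts creates no new zeros. *)
suff -> : count (predC1 0) (map Re srho) = #|[pred j | D 0 j != 0]|.
  by rewrite -lecR (rmorphM (real_complex R)) /= rmorph_nat rmorph1 -aE.
rewrite count_map (seq.permP sD) count_map enumT cardE /enum_mem size_filter.
apply: eq_count => j; rewrite /= inE; congr (~~ _).
have := D_ge0 j; rewrite lecE => /andP[/eqP Dj _].
by case: (D 0 j) Dj => x y /= ->; rewrite eq_complex /= eqxx andbT.
Qed.

End RealSpectrum.

(** * The additive character of ['Z_d] *)

Section Character.
Variables (R : realType) (d : nat).
Hypothesis d_prime : prime d.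
Local Notation C := R[i].
Local Notation omega := (omega R d).
Local Notation chi := (@chi R d).

Let d_gt1 : (1 < d)%N := prime_gt1 d_prime.

Lemma omegaX k : omega ^+ k =
  (cos (2 * pi / d%:R *+ k) +i* sin (2 * pi / d%:R *+ k))%C.
Proof.
elim: k => [|k IHk]; first by rewrite expr0 mulr0n cos0 sin0.
rewrite exprS IHk [_ *+ k.+1]mulrS cosD sinD; apply/eqP; rewrite eq_complex /=.
by rewrite eqxx /= addrC.
Qed.

Lemma omega_order : omega ^+ d = 1.
Proof.
rewrite omegaX -mulr_natr divfK; last by rewrite pnatr_eq0 -lt0n ltnW.
by rewrite mulr_natl cos2pi sin2pi.
Qed.

(** For [d = 2] the cosine is -1; for [d > 2] the angle lies strictly between 0 and [pi], so the
    sine is positive. *)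
Lemma omega_neq1 : omega != 1.
Proof.
rewrite /omega eq_complex /= negb_and.
have [->|d_neq2] := eqVneq d 2%N.
  by rewrite mulrAC divff ?pnatr_eq0 // mul1r cospi lt_eqF //; lra.
apply/orP; right; rewrite gt_eqF // sin_gt0_pi //.
have d_gt2 : 2 < d%:R :> R by rewrite ltr_nat ltn_neqAle eq_sym d_neq2.
have d_gt0 : 0 < d%:R :> R by apply: lt_trans d_gt2.
rewrite divr_gt0 ?mulr_gt0 ?pi_gt0 //= ltr_pdivrMr // mulrC ltr_pM2l //.
exact: pi_gt0.
Qed.

Lemma chiE (a : 'Z_d) : chi a = omega ^+ a. Proof. by []. Qed.

Lemma chi0 : chi 0 = 1.
Proof. by rewrite chiE expr0. Qed.

Lemma chi1 : chi 1 = omega.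
Proof. by rewrite chiE /= modn_small. Qed.

Lemma chiD a b : chi (a + b) = chi a * chi b.
Proof.
(* ['Z_d] computes modulo [(Zp_trunc d).+2], which is [d] because [1 < d]. *)
have omega1 : omega ^+ (Zp_trunc d).+2 = 1 by rewrite Zp_cast // omega_order.
by rewrite !chiE -exprD /= expr_mod.
Qed.

Lemma chi_sum (I : finType) (F : I -> 'Z_d) :
  chi (\sum_i F i) = \prod_i chi (F i).
Proof. exact: (big_morph _ chiD chi0). Qed.

Lemma chiMn a k : chi (a *+ k) = chi a ^+ k.
Proof. by elim: k => [|k IHk]; rewrite ?chi0 // mulrS chiD IHk exprS. Qed.

Lemma chiM a b : chi (a * b) = chi a ^+ b.
Proof. by rewrite -[b in LHS]natr_Zp mulr_natr chiMn. Qed.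

Lemma chi_norm a : `|chi a| = 1.
Proof.
rewrite chiE normrX; suff -> : `|omega| = 1 by rewrite expr1n.
by rewrite normc_def /= cos2Dsin2 sqrtr1.
Qed.

Lemma chiN a : chi (- a) = (chi a)^*%R.
Proof.
apply: (mulfI (_ : chi a != 0)); first by rewrite -normr_eq0 chi_norm oner_eq0.
by rewrite -chiD subrr chi0 -normCK chi_norm expr1n.
Qed.

Lemma Zp_prime_unit (a : 'Z_d) : a != 0 -> a \is a GRing.unit.
Proof.
move=> a0; rewrite -[a]natr_Zp unitZpE // prime_coprime //.
rewrite gtnNdvd //; last by rewrite -[X in (_ < X)%N](Zp_cast d_gt1) ltn_ord.
by rewrite lt0n; apply: contra a0 => a0; apply/eqP/val_inj/eqP.
Qed.

(** Primality makes [a] invertible, and [chi 1] is then a power of [chi a]. *)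
Lemma chi_neq1 a : a != 0 -> chi a != 1.
Proof.
move=> /Zp_prime_unit a_unit; apply: contra omega_neq1 => /eqP chi_a.
by rewrite -chi1 -(mulrV a_unit) chiM chi_a expr1n.
Qed.

End Character.

(** * Weyl operators on [n] qudits: entries, products, adjoints, completeness *)

Section Weyl.
Variables (R : realType) (d n : nat).
Hypothesis d_prime : prime d.
Local Notation C := R[i].
Local Notation chi := (@chi R d).
Local Notation m := #|Qn d n|.

Let d_gt1 : (1 < d)%N := prime_gt1 d_prime.

Lemma ZopX k : Zop R d ^+ k =
  \matrix_(i, j) ((i == j)%:R * chi (enum_val j) ^+ k).
Proof.
elim: k => [|k IHk].
  by rewrite expr0; apply/matrixP => i j; rewrite !mxE expr0 mulr1.
rewrite exprS IHk; apply/matrixP => i j; rewrite !mxE (bigD1 i) //= big1.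
  rewrite !mxE eqxx addr0 mul1r exprS.
  by have [->|] := eqVneq i j; rewrite ?mul1r // !mul0r mulr0.
by move=> l l_i; rewrite !mxE eq_sym (negPf l_i) !mul0r.
Qed.

Lemma XopX k : Xop R d ^+ k =
  \matrix_(i, j) (enum_val i == enum_val j + k%:R :> 'Z_d)%:R.
Proof.
elim: k => [|k IHk].
  rewrite expr0; apply/matrixP => i j.
  by rewrite !mxE addr0 (inj_eq enum_val_inj).
rewrite exprS IHk; apply/matrixP => i j; rewrite !mxE.
rewrite (bigD1 (enum_rank (enum_val j + k%:R : 'Z_d))) //= big1.
  by rewrite !mxE enum_rankK eqxx mulr1 addr0 -addrA -natr1.
move=> l; rewrite -(inj_eq enum_val_inj) enum_rankK !mxE => /negPf ->.
by rewrite mulr0.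
Qed.

Definition phase1 (p q : 'Z_d) : C :=
  if d == 2 then 'i%C ^- (val p * val q) else chi (- (2%:R)^-1 * p * q).

Lemma weyl1E p q i j : weyl1 R p q i j =
  phase1 p q * chi (p * enum_val i) * (enum_val i == enum_val j + q)%:R.
Proof.
rewrite /weyl1 ZopX XopX !mxE (bigD1 i) //= big1 => [|l l_i].
  by rewrite !mxE eqxx mul1r addr0 natr_Zp [p * _]mulrC [chi (enum_val i * p)]chiM // mulrA.
by rewrite !mxE eq_sym (negPf l_i) !mul0r.
Qed.

Lemma phase1_norm p q : `|phase1 p q| = 1.
Proof.
rewrite /phase1; case: ifP => _; last exact: chi_norm.
by rewrite normfV normrX normc_def /= expr0n expr1n add0r sqrtr1 expr1n invr1.
Qed.

(** For [d = 2] negation is trivial and squaring turns powers of ['i] into powers of -1, the value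
    of [omega]; for odd [d] the two halves of [- (p * q)] add up. *)
Lemma phase1N p q : phase1 p q * phase1 (- p) (- q) = chi (- (p * q)).
Proof.
rewrite /phase1; case: eqP => [d2|/eqP d_neq2].
  have N2 (a : 'Z_d) : - a = a.
    apply/esym/eqP; rewrite -addr_eq0 -mulr2n -mulr_natr.
    suff -> : 2%:R = 0 :> 'Z_d by rewrite mulr0.
    by rewrite -[RHS](pchar_Zp d_gt1); congr (_ *+ _).
  have omegaN1 : omega R d = -1.
    rewrite /omega d2 mulrAC divff ?pnatr_eq0 // mul1r cospi sinpi.
    by apply/eqP; rewrite eq_complex /= oppr0 !eqxx.
  rewrite !N2 -invfM -expr2 -exprM mulnC exprM sqr_i.
  rewrite chiM // chiE omegaN1 -exprM -exprVn.
  by rewrite invrN1.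
have two_unit : (2%:R : 'Z_d) \is a GRing.unit.
  rewrite unitZpE // coprimen2; case: (even_prime d_prime) => // d2.
  by rewrite d2 in d_neq2.
rewrite -chiD //; congr (chi _).
transitivity (- ((2%:R^-1 * 2%:R) * (p * q))); first by ring.
by rewrite mulVr // mul1r.
Qed.

Definition dot (p u : Qn d n) : 'Z_d := \sum_k p k * u k.

Definition phase (p q : Qn d n) : C := \prod_k phase1 (p k) (q k).

Lemma weylE p q i j : weyl R p q i j =
  phase p q * chi (dot p (enum_val i)) * (enum_val i == enum_val j + q)%:R.
Proof.
rewrite mxE (eq_bigr _ (fun k _ => weyl1E _ _ _ _)) !big_split /=.
rewrite /dot chi_sum //; congr (_ * _ * _).
  by apply: eq_bigr => k _; rewrite enum_rankK.
under eq_bigr do rewrite !enum_rankK.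
have [eq_ij|neq_ij] := eqVneq.
  by rewrite big1 // => k _; rewrite eq_ij ffunE eqxx.
have [k neq_k] : exists k, enum_val i k != enum_val j k + q k.
  apply/existsP; apply: contraNT neq_ij => /existsPn eq_k.
  by apply/eqP/ffunP => k; rewrite ffunE; apply/eqP; have := eq_k k; rewrite negbK.
by rewrite (bigD1 k) //= (negPf neq_k) mul0r.
Qed.

Lemma phase_norm p q : `|phase p q| = 1.
Proof. by rewrite normr_prod big1 // => k _; rewrite phase1_norm. Qed.

Lemma dotDl p p' u : dot (p + p') u = dot p u + dot p' u.
Proof. by rewrite -big_split; apply: eq_bigr => k _; rewrite ffunE mulrDl. Qed.

Lemma dotDr p u u' : dot p (u + u') = dot p u + dot p u'.
Proof. by rewrite -big_split; apply: eq_bigr => k _; rewrite ffunE mulrDr. Qed.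

Lemma dotNl p u : dot (- p) u = - dot p u.
Proof. by rewrite -sumrN; apply: eq_bigr => k _; rewrite ffunE mulNr. Qed.

Lemma dotNr p u : dot p (- u) = - dot p u.
Proof. by rewrite -sumrN; apply: eq_bigr => k _; rewrite ffunE mulrN. Qed.

Lemma phaseN p q : phase p q * phase (- p) (- q) = chi (- dot p q).
Proof.
rewrite -big_split -sumrN chi_sum //=.
by apply: eq_bigr => k _; rewrite !ffunE phase1N.
Qed.

Lemma phase_conj p q : (phase p q)^*%R = phase (- p) (- q) * chi (dot p q).
Proof.
have nz : phase p q != 0 by rewrite -normr_eq0 phase_norm oner_eq0.
apply: (mulfI nz); rewrite -normCK phase_norm expr1n mulrA phaseN.
by rewrite -chiD // addNr chi0.
Qed.

(** Orthogonality of characters: if [w k] is nonzero, shifting [p] by the [k]-th unit vector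
    multiplies the sum by [chi (w k)], which differs from 1. *)
Lemma sum_chi_dot (w : Qn d n) : \sum_p chi (dot p w) = (m * (w == 0))%:R.
Proof.
have [->|w0] := eqVneq w 0.
  rewrite (eq_bigr (fun=> 1)) => [|p _]; first by rewrite sumr_const muln1.
  rewrite (_ : dot p 0 = 0) ?chi0 // /dot big1 // => k _.
  by rewrite ffunE mulr0.
rewrite muln0; have [k wk] : exists k, w k != 0.
  by apply/existsP; apply: contraNT w0 => /existsPn eq_k;
    apply/eqP/ffunP => k; apply/eqP; rewrite ffunE; have := eq_k k; rewrite negbK.
pose e : Qn d n := [ffun l => (l == k)%:R].
have dot_e : dot e w = w k.
  rewrite /dot (bigD1 k) //= big1 => [|l /negPf lk]; rewrite ffunE ?lk ?mul0r //.
  by rewrite eqxx mul1r addr0.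
set s := \sum_p _; have : chi (w k) * s = s.
  rewrite mulr_sumr [RHS](reindex_inj (addrI e)).
  by apply: eq_bigr => p _; rewrite dotDl dot_e chiD.
move/eqP; rewrite -subr_eq0 -[X in _ - X]mul1r -mulrBl mulf_eq0 subr_eq0.
by rewrite (negPf (chi_neq1 _ d_prime wk)) => /eqP.
Qed.

(** The named product carries both the finite and the additive structure, as the index group of the
    abstract argument must. *)
Definition phase_space := (Qn d n * Qn d n)%type.
HB.instance Definition _ := Finite.on phase_space.
HB.instance Definition _ := GRing.Zmodule.on phase_space.

Definition weylx (x : phase_space) : 'M[C]_m := weyl R x.1 x.2.

(** The character factor comes from moving the shift by [x.2] past the clock operator of [y.1]. The
    quotient of phases covers [d = 2] and odd [d] uniformly. *)
Definition cocycle (x y : phase_space) : C :=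
  phase x.1 x.2 * phase y.1 y.2 / phase (x + y).1 (x + y).2 *
  chi (- dot y.1 x.2).

Lemma phase0 : phase 0 0 = 1.
Proof.
rewrite /phase big1 // => k _; rewrite !ffunE /phase1.
by case: ifP => _; rewrite ?mulr0 ?chi0 // expr0 invr1.
Qed.

Lemma weylx0 : weylx 0 = 1%:M.
Proof.
apply/matrixP => i j; rewrite weylE phase0 !mxE addr0 (inj_eq enum_val_inj).
by rewrite /dot big1 ?chi0 ?mul1r // => k _; rewrite ffunE mul0r.
Qed.

Lemma weylxM x y : weylx x *m weylx y = cocycle x y *: weylx (x + y).
Proof.
apply/matrixP => i j; rewrite mxE [RHS]mxE (bigD1 (enum_rank (enum_val j + y.2))) //=.
rewrite big1 => [|l]; last first.
  by rewrite -(inj_eq enum_val_inj) enum_rankK !weylE => /negPf ->; rewrite !mulr0.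
rewrite !weylE enum_rankK eqxx addr0 mulr1 /cocycle /=.
have nz : phase (x.1 + y.1) (x.2 + y.2) != 0.
  by rewrite -normr_eq0 phase_norm oner_eq0.
have -> : enum_val j + y.2 + x.2 = enum_val j + (x.2 + y.2).
  by rewrite -addrA [y.2 + _]addrC.
case: eqP => [uE|_]; last by rewrite !mulr0 mul0r.
rewrite dotDl chiD // !mulr1.
have -> : chi (dot y.1 (enum_val j + y.2)) =
    chi (- dot y.1 x.2) * chi (dot y.1 (enum_val i)).
  by rewrite -chiD // uE -dotNr -dotDr addrCA addKr.
by field.
Qed.

Lemma cocycle_norm x y : `|cocycle x y| = 1.
Proof. by rewrite !normrM normfV !phase_norm chi_norm // invr1 !mulr1. Qed.

Lemma weylx_adj x : (weylx x)^t* = weylx (- x).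
Proof.
apply/matrixP => i j; rewrite mxE [_^T i j]mxE !weylE !rmorphM.
rewrite /= conjC_nat phase_conj -chiN //.
have -> : (enum_val i == enum_val j + - x.2) = (enum_val j == enum_val i + x.2).
  by rewrite eq_sym subr_eq.
case: eqP => [->|_]; last by rewrite !mulr0.
rewrite !mulr1 -mulrA; congr (_ * _).
by rewrite dotNl -chiD // dotDr opprD addrCA subrr addr0.
Qed.

Lemma weylx_unit x : weylx x *m weylx (- x) = 1%:M.
Proof.
rewrite weylxM subrr weylx0 /cocycle /= !subrr phase0 divr1 phaseN.
by rewrite dotNl opprK -chiD // addNr chi0 scale1r.
Qed.

(** Entry by entry, the expansion reduces to the orthogonality relation [orth], a character sum over
    [p] once [q] is fixed by the shifts. *)
Lemma weylx_complete (A : 'M[C]_m) :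
  m%:R *: A = \sum_x \tr (A *m weylx (- x)) *: weylx x.
Proof.
have orth i j k l : \sum_x weylx (- x) l k * weylx x i j =
    (m * ((k == i) && (l == j)))%:R.
  set u := enum_val i; set v := enum_val j.
  set t := enum_val k; set s := enum_val l.
  transitivity (\sum_p \sum_q (phase p q * phase (- p) (- q) *
     chi (dot p (u - s)) * (u == v + q)%:R * (t == s + q)%:R)).
    rewrite pair_bigA; apply: eq_bigr => -[p q] _ /=.
    rewrite !weylE /= dotNl dotDr dotNr chiD // -/u -/v -/s -/t.
    by rewrite eq_sym subr_eq; ring.
  (* Only [q = u - v] survives, and [phaseN] supplies [chi (- dot p (u - v))], which changes [u - s]
     into [v - s]. *)
  transitivity (\sum_p chi (dot p (v - s)) * (t == s + (u - v))%:R).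
    apply: eq_bigr => p _; rewrite (bigD1 (u - v)) //= big1 => [|q /negPf quv].
      rewrite addr0 phaseN -chiD // [v + _]addrC subrK eqxx mulr1 -dotNr -dotDr.
      by congr (chi (dot _ _) * _); rewrite opprB subrKA.
    suff -> : (u == v + q) = false by rewrite mulr0 mul0r.
    by rewrite [v + q]addrC -subr_eq eq_sym quv.
  rewrite -mulr_suml sum_chi_dot -natrM -mulnA; congr (_ * _)%:R.
  rewrite mulnb subr_eq0 andbC (inj_eq enum_val_inj) [j == l]eq_sym.
  have [lj|_] := eqVneq l j; last by rewrite !andbF.
  by rewrite !andbT /s lj subrKC (inj_eq enum_val_inj).
apply/matrixP => i j; rewrite summxE mxE.
transitivity (\sum_k \sum_l A k l * \sum_x weylx (- x) l k * weylx x i j).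
  rewrite (bigD1 i) //= (bigD1 j) //= orth !eqxx muln1.
  rewrite big1 => [|l /negPf lj]; last by rewrite orth lj andbF muln0 mulr0.
  rewrite big1 => [|k /negPf ki]; last first.
    by rewrite big1 // => l _; rewrite orth ki muln0 mulr0.
  by rewrite !addr0 mulrC.
under eq_bigr do under eq_bigr do rewrite mulr_sumr.
under eq_bigr do rewrite exchange_big /=.
rewrite exchange_big /=; apply: eq_bigr => x _.
rewrite [RHS]mxE /mxtrace mulr_suml; apply: eq_bigr => k _.
by rewrite [(A *m _) k k]mxE mulr_suml; apply: eq_bigr => l _; rewrite mulrA.
Qed.

Lemma charfunE (A : 'M[C]_m) p q :
  charfun A p q = \tr (A *m weylx (- (p, q))).
Proof.
rewrite /charfun /weylx /=; congr (\tr (_ *m weyl R _ _));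
  by apply/ffunP => k; rewrite !ffunE.
Qed.

End Weyl.

(** * Majorization for the mean state of an [n]-qudit state *)

Lemma card_Qn d n : (1 < d)%N -> #|Qn d n| = (d ^ n)%N.
Proof. by move=> d_gt1; rewrite card_ffun !card_ord Zp_cast. Qed.

Theorem mainTheorem3 (R : realType) (d n : nat)
  (rho M : 'M[R[i]]_#|Qn d n|) (srho sM : seq R[i]) :
  prime d -> (0 < n)%N ->
  is_state rho -> is_mean_state rho M ->
  is_spectrum rho srho -> is_spectrum M sM ->
  majorized (map (@complex.Re R) sM) (map (@complex.Re R) srho) /\
  (forall f : seq R -> R, schur_concave (d ^ n) f ->
     f (map (@complex.Re R) srho) <= f (map (@complex.Re R) sM)).
Proof.
move=> d_prime _ [rho_psd rho_tr] M_mean rhoS MS.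
have d_gt1 := prime_gt1 d_prime.
have m_gt0 : (0 < #|Qn d n|)%N by rewrite card_Qn // expn_gt0 ltnW.
have [L rhoE] : exists L : 'M[R[i]]_#|Qn d n|, rho = L *m L^t*.
  have [rho_adj rho_ge0] := rho_psd; rewrite map_trmx in rho_adj.
  by apply: (psd_factor rho_adj) => v; have := rho_ge0 v; rewrite map_trmx.
subst rho.
(* The defining property is restated with pairs [(p, q)] as single points of phase space, as the
   stabilizer argument requires. *)
have M_meanx (x : phase_space d n) : \tr (M *m weylx R (- x)) =
    if `|\tr (L *m L^t* *m weylx R (- x))| == 1
    then \tr (L *m L^t* *m weylx R (- x)) else 0.
  by case: x => p q; rewrite -!charfunE M_mean.
have [a [a_gt0 Madj MM Mrho Mtr]] :=
  mean_state_projection m_gt0 (weylx0 R n d_prime) (weylxM R d_prime)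
    (@cocycle_norm R d n) (weylx_adj R d_prime) (weylx_unit R d_prime)
    (weylx_complete d_prime) rho_tr M_meanx.
have [q_prob p_prob maj] := scaled_projection_majorized m_gt0 rho_psd rho_tr
  a_gt0 Madj MM Mrho Mtr rhoS MS.
split=> // f f_concave; rewrite card_Qn // in q_prob p_prob.
exact: f_concave.
Qed.
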